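(* Let $G(\lambda)\in\mathbb F(\lambda)^{p\times m}$ and let $L(\lambda)$ be a strong block minimal bases linearization of $G(\lambda)$ as in the context. (a) $\begin{bmatrix}H_1(\lambda)\\H_2(\lambda)\\H_3(\lambda)\end{bmatrix}$ (blocks with $n$, $m+\widehat m$, $\widehat p$ rows) is a right minimal basis of $L(\lambda)$ if and only if $H_1(\lambda)=-S^{-1}(\lambda I_n-A)^{-1}BH(\lambda)$, $H_2(\lambda)=N_1(\lambda)^TH(\lambda)$ and $H_3(\lambda)=-\widehat N_2(\lambda)M(\lambda)N_1(\lambda)^TH(\lambda)$ for some right minimal basis $H(\lambda)$ of $G(\lambda)$. (b) $\begin{bmatrix}H_1(\lambda)\\H_2(\lambda)\\H_3(\lambda)\end{bmatrix}$ (blocks with $n$, $p+\widehat p$, $\widehat m$ rows) is a left minimal basis of $L(\lambda)$ if and only if $H_1(\lambda)=(C(\lambda I_n-A)^{-1}T^{-1})^TH(\lambda)$, $H_2(\lambda)=N_2(\lambda)^TH(\lambda)$ and $H_3(\lambda)=-\widehat N_1(\lambda)M(\lambda)^TN_2(\lambda)^TH(\lambda)$ for some left minimal basis $H(\lambda)$ of $G(\lambda)$.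
   Context: $\mathbb F$ is an arbitrary field. A polynomial matrix $K\in\mathbb F[\lambda]^{a\times b}$, $a<b$, is a minimal basis if its rows form a minimal basis (polynomial basis of least total degree) of the subspace they span; $K\in\mathbb F[\lambda]^{a_1\times b}$, $N\in\mathbb F[\lambda]^{a_2\times b}$ are dual minimal bases if both are minimal bases, $a_1+a_2=b$ and $KN^T=0$. Strong block minimal bases linearization: write $G=D+C(\lambda I_n-A)^{-1}B$ with $D$ the polynomial part, $\deg D>1$, and $C(\lambda I_n-A)^{-1}B$ a minimal order state-space realization of the strictly proper part. Let $K_1\in\mathbb F[\lambda]^{\widehat m\times(m+\widehat m)}$, $K_2\in\mathbb F[\lambda]^{\widehat p\times(p+\widehat p)}$ be minimal bases with all row degrees $1$, $N_1\in\mathbb F[\lambda]^{m\times(m+\widehat m)}$, $N_2\in\mathbb F[\lambda]^{p\times(p+\widehat p)}$ minimal bases dual to $K_1,K_2$, each with all row degrees equal, and $M(\lambda)$ a $(p+\widehat p)\times(m+\widehat m)$ pencil with $D=N_2MN_1^T$ and $\deg D=\deg N_1+\deg N_2+1$. Let $\widehat K_1\in\mathbb F^{m\times(m+\widehat m)}$, $\widehat K_2\in\mathbb F^{p\times(p+\widehat p)}$, $\widehat N_1\in\mathbb F[\lambda]^{\widehat m\times(m+\widehat m)}$, $\widehat N_2\in\mathbb F[\lambda]^{\widehat p\times(p+\widehat p)}$ be such that $\begin{bmatrix}K_i\\ \widehat K_i\end{bmatrix}$ is unimodular with inverse $\begin{bmatrix}\widehat N_i^T & N_i^T\end{bmatrix}$,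 $i=1,2$. For nonsingular $T,S\in\mathbb F^{n\times n}$, $L(\lambda)=\begin{bmatrix}T(\lambda I_n-A)S & TB\widehat K_1 & 0\\ -\widehat K_2^TCS & M(\lambda) & K_2(\lambda)^T\\ 0 & K_1(\lambda) & 0\end{bmatrix}$. A right (left) minimal basis of a rational matrix $G$ is a polynomial matrix whose columns form a minimal basis of $\mathcal N_r(G)=\{x:Gx=0\}$ ($\mathcal N_\ell(G)=\{x:x^TG=0\}$). *)

(* Defs.v *)
From HB Require Import structures.
From mathcomp Require Import all_boot all_order all_algebra.
Set Implicit Arguments. Unset Strict Implicit. Unset Printing Implicit Defensive.
Import Order.TTheory GRing.Theory Num.Theory.
Local Open Scope ring_scope.

Notation ratf F := {fraction {poly F}}.

Definition pfrac (F : fieldType) (q : {poly F}) : ratf F := @FracField.tofrac _ q.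
Definition frac_mx (F : fieldType) (a b : nat) (K : 'M[{poly F}]_(a, b))
  : 'M[ratf F]_(a, b) := map_mx (@pfrac F) K.
Definition const_pmx (F : fieldType) (a b : nat) (K : 'M[F]_(a, b))
  : 'M[{poly F}]_(a, b) := map_mx polyC K.

(* degree of a polynomial (deg 0 := 0) *)
Definition pdeg (F : fieldType) (q : {poly F}) : nat := (size q).-1.
Definition rowdeg (F : fieldType) (a b : nat) (K : 'M[{poly F}]_(a, b)) (i : 'I_a)
  : nat := (\max_(j < b) pdeg (K i j))%N.
Definition mxdeg (F : fieldType) (a b : nat) (K : 'M[{poly F}]_(a, b)) : nat :=
  (\max_(i < a) rowdeg K i)%N.
Definition totdeg (F : fieldType) (a b : nat) (K : 'M[{poly F}]_(a, b)) : nat :=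
  (\sum_(i < a) rowdeg K i)%N.

Definition minimal_basis (F : fieldType) (a b : nat) (K : 'M[{poly F}]_(a, b))
  : Prop :=
  [/\ (a < b)%N, row_free (frac_mx K) &
      forall K' : 'M[{poly F}]_(a, b),
        row_free (frac_mx K') -> (frac_mx K' == frac_mx K)%MS ->
        (totdeg K <= totdeg K')%N].

Definition dual_minimal_bases (F : fieldType) (a1 a2 b : nat)
  (K : 'M[{poly F}]_(a1, b)) (N : 'M[{poly F}]_(a2, b)) : Prop :=
  [/\ minimal_basis K, minimal_basis N, (a1 + a2 = b)%N & K *m N^T = 0].

Definition right_minimal_basis (F : fieldType) (p m k : nat)
  (G : 'M[ratf F]_(p, m)) (H : 'M[{poly F}]_(m, k)) : Prop :=
  minimal_basis H^T /\ (frac_mx H^T == kermx G^T)%MS.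

Definition left_minimal_basis (F : fieldType) (p m k : nat)
  (G : 'M[ratf F]_(p, m)) (H : 'M[{poly F}]_(p, k)) : Prop :=
  minimal_basis H^T /\ (frac_mx H^T == kermx G)%MS.

Definition pencilA (F : fieldType) (n : nat) (A : 'M[F]_n) : 'M[{poly F}]_n :=
  'X%:M - const_pmx A.

Definition transfer (F : fieldType) (p m n : nat)
  (C : 'M[F]_(p, n)) (A : 'M[F]_n) (B : 'M[F]_(n, m)) : 'M[ratf F]_(p, m) :=
  frac_mx (const_pmx C) *m invmx (frac_mx (pencilA A)) *m frac_mx (const_pmx B).

Definition minimal_order_realization (F : fieldType) (p m n : nat)
  (C : 'M[F]_(p, n)) (A : 'M[F]_n) (B : 'M[F]_(n, m)) : Prop :=
  forall (n' : nat) (C' : 'M[F]_(p, n')) (A' : 'M[F]_n') (B' : 'M[F]_(n', m)),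
    transfer C' A' B' = transfer C A B -> (n <= n')%N.

Definition is_pencil (F : fieldType) (a b : nat) (M : 'M[{poly F}]_(a, b)) : Prop :=
  forall i j, (size (M i j) <= 2)%N.

Definition sbmb_lin (F : fieldType) (p m n ph mh : nat)
  (T S A : 'M[F]_n) (B : 'M[F]_(n, m)) (C : 'M[F]_(p, n))
  (M : 'M[{poly F}]_(p + ph, m + mh))
  (K1 : 'M[{poly F}]_(mh, m + mh)) (K2 : 'M[{poly F}]_(ph, p + ph))
  (K1h : 'M[F]_(m, m + mh)) (K2h : 'M[F]_(p, p + ph))
  : 'M[{poly F}]_(n + ((p + ph) + mh), n + ((m + mh) + ph)) :=
  col_mx
    (row_mx (const_pmx T *m pencilA A *m const_pmx S)
            (row_mx (const_pmx (T *m B *m K1h)) 0))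
    (col_mx
      (row_mx (- const_pmx (K2h^T *m C *m S)) (row_mx M K2^T))
      (row_mx 0 (row_mx K1 0))).

(* Main.v *)
Require Import Defs.
From HB Require Import structures.
From mathcomp Require Import all_boot all_order all_algebra.
Set Implicit Arguments. Unset Strict Implicit. Unset Printing Implicit Defensive.
Import Order.TTheory GRing.Theory Num.Theory.
Local Open Scope ring_scope.

(* The map y |-> z = (-S^-1 (lambda I - A)^-1 B y, N1^T y, -N2h M N1^T y) is an
   isomorphism from the right kernel of G onto that of L, with polynomial left
   inverse z |-> K1h z2. Observability (from the minimality of the realization)
   makes it send polynomial vectors to polynomial vectors. It shifts degrees by
   exactly deg N1: row reducedness of N1 gives deg (N1^T y) = deg N1 + deg y,
   and the equations L z = 0 together with the row reducedness of the pencils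
   lambda I - A and K2 bound the degrees of the two other blocks by this one.
   Such a map identifies minimal bases. The left-hand statement is the right-hand
   one for L^T, the linearization of G^T built from (-C^T, -B^T). *)

(** * Polynomial matrices as matrices of rational functions *)

Lemma pfrac_zmod_morphism (F : fieldType) : zmod_morphism (@pfrac F).
Proof. exact: rmorphB. Qed.

Lemma pfrac_monoid_morphism (F : fieldType) : monoid_morphism (@pfrac F).
Proof. by split; [exact: rmorph1 | exact: rmorphM]. Qed.

(** These instances open the [map_mx] theory to [frac_mx]. *)
HB.instance Definition _ (F : fieldType) :=
  GRing.isZmodMorphism.Build {poly F} (ratf F) (@pfrac F)
    (@pfrac_zmod_morphism F).
HB.instance Definition _ (F : fieldType) :=
  GRing.isMonoidMorphism.Build {poly F} (ratf F) (@pfrac F)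
    (@pfrac_monoid_morphism F).

Lemma pfrac_eq0 (F : fieldType) (q : {poly F}) : (pfrac q == 0) = (q == 0).
Proof. exact: tofrac_eq0. Qed.

Lemma pfrac_inj (F : fieldType) : injective (@pfrac F).
Proof. by move=> q r /eqP; rewrite tofrac_eq => /eqP. Qed.

Section FracMx.
Variable F : fieldType.
Implicit Types a b c : nat.

Lemma frac_mxM a b c (K : 'M[{poly F}]_(a, b)) (N : 'M_(b, c)) :
  frac_mx (K *m N) = frac_mx K *m frac_mx N.
Proof. exact: map_mxM. Qed.

Lemma frac_mxD a b (K N : 'M[{poly F}]_(a, b)) :
  frac_mx (K + N) = frac_mx K + frac_mx N.
Proof. exact: map_mxD. Qed.

Lemma frac_mxN a b (K : 'M[{poly F}]_(a, b)) : frac_mx (- K) = - frac_mx K.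
Proof. exact: map_mxN. Qed.

Lemma frac_mxZ a b x (K : 'M[{poly F}]_(a, b)) :
  frac_mx (x *: K) = pfrac x *: frac_mx K.
Proof. exact: map_mxZ. Qed.

Lemma frac_mx0 a b : frac_mx (0 : 'M[{poly F}]_(a, b)) = 0.
Proof. exact: map_mx0. Qed.

Lemma frac_mx1 a : frac_mx (1%:M : 'M[{poly F}]_a) = 1%:M.
Proof. exact: map_mx1. Qed.

Lemma frac_mx_tr a b (K : 'M[{poly F}]_(a, b)) : frac_mx K^T = (frac_mx K)^T.
Proof. by rewrite /frac_mx map_trmx. Qed.

Lemma frac_mx_inj a b : injective (@frac_mx F a b).
Proof.
move=> K N /matrixP eqKN; apply/matrixP => i j.
by have := eqKN i j; rewrite !mxE => /pfrac_inj.
Qed.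

Lemma frac_mx_row a b c (K : 'M[{poly F}]_(a, b)) (N : 'M_(a, c)) :
  frac_mx (row_mx K N) = row_mx (frac_mx K) (frac_mx N).
Proof. exact: map_row_mx. Qed.

Lemma frac_mx_col a b c (K : 'M[{poly F}]_(a, b)) (N : 'M_(c, b)) :
  frac_mx (col_mx K N) = col_mx (frac_mx K) (frac_mx N).
Proof. exact: map_col_mx. Qed.

Lemma const_pmxM a b c (K : 'M[F]_(a, b)) (N : 'M_(b, c)) :
  const_pmx (K *m N) = const_pmx K *m const_pmx N.
Proof. exact: map_mxM. Qed.

Lemma const_pmxN a b (K : 'M[F]_(a, b)) : const_pmx (- K) = - const_pmx K.
Proof. exact: map_mxN. Qed.

Lemma const_pmx_tr a b (K : 'M[F]_(a, b)) : const_pmx K^T = (const_pmx K)^T.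
Proof. by rewrite /const_pmx map_trmx. Qed.

Lemma const_pmx1 a : const_pmx (1%:M : 'M[F]_a) = 1%:M.
Proof. exact: map_mx1. Qed.

(** * Row degrees and leading row coefficients *)

Lemma row_free_row_neq0 (E : fieldType) a b (K : 'M[E]_(a, b)) i :
  row_free K -> row i K != 0.
Proof.
move=> Kfree; rewrite rowE mulmx_free_eq0 //.
by apply/eqP=> /matrixP/(_ 0 i)/eqP; rewrite !mxE !eqxx oner_eq0.
Qed.

Lemma rowdeg_leP a b (K : 'M[{poly F}]_(a, b)) i e :
  reflect (forall j, (size (K i j) <= e.+1)%N) (rowdeg K i <= e)%N.
Proof.
apply: (iffP idP) => [le_e j | le_e].
  have: (pdeg (K i j) <= e)%N by apply: leq_trans le_e; exact: leq_bigmax.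
  by rewrite /pdeg; case: (size _).
by apply/bigmax_leqP => j _; rewrite /pdeg; have := le_e j; case: (size _).
Qed.

Lemma rowdeg_geP a b (K : 'M[{poly F}]_(a, b)) i e j :
  (K i j)`_e != 0 -> (e <= rowdeg K i)%N.
Proof.
move=> nz; apply: leq_trans (leq_bigmax j).
by rewrite /pdeg -ltnS (leq_trans _ (leqSpred _)) // ltnNge;
   apply: contra nz => /leq_sizeP ->.
Qed.

Lemma rowdeg_coef a b (K : 'M[{poly F}]_(a, b)) i :
  row i K != 0 -> exists j, (K i j)`_(rowdeg K i) != 0.
Proof.
move=> nzK; case e_def: (rowdeg K i) => [|e].
  (* As [pdeg] is 0 on the zero polynomial too, degree 0 is where [nzK] is needed, to find a nonzero
     constant. *)
  have [j nzj] : exists j, K i j != 0.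
    apply/existsP; apply: contraR nzK; rewrite negb_exists => /forallP z.
    by apply/eqP/rowP => j; rewrite !mxE; have := z j; rewrite negbK => /eqP.
  exists j; move: (nzj); rewrite -lead_coef_eq0 lead_coefE.
  have /rowdeg_leP/(_ j) : (rowdeg K i <= 0)%N by rewrite e_def.
  by case: (size _) => [|[]].
apply/existsP; apply: contraFT (ltnn e); rewrite negb_exists => /forallP z.
rewrite -[X in (X <= _)%N]e_def.
apply/rowdeg_leP => j; apply/leq_sizeP => l; rewrite leq_eqVlt => /orP[/eqP<-|lt].
  by have := z j; rewrite negbK => /eqP.
have /rowdeg_leP/(_ j)/leq_sizeP : (rowdeg K i <= e.+1)%N by rewrite e_def.
exact.
Qed.

(** When all row degrees equal [d], this is the leading row coefficient matrix, and its full row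
    rank is row reducedness. *)
Definition coef_mx a b (d : nat) (K : 'M[{poly F}]_(a, b)) : 'M[F]_(a, b) :=
  \matrix_(i, j) (K i j)`_d.

Lemma coefM_top (q r : {poly F}) e d :
  (size q <= e.+1)%N -> (size r <= d.+1)%N -> (q * r)`_(e + d) = q`_e * r`_d.
Proof.
move=> szq szr; have lt_e : (e < (e + d).+1)%N by rewrite ltnS leq_addr.
rewrite coefM (bigD1 (Ordinal lt_e)) //= addKn big1 ?addr0 // => j ne.
have [lt_j|le_j] := ltnP e j.
  by rewrite (leq_sizeP _ _ szq) ?mul0r.
have lt_je : (j < e)%N by rewrite ltn_neqAle le_j andbT.
rewrite [r`_ _](leq_sizeP _ _ szr) ?mulr0 //.
by rewrite ltn_subRL ltn_add2r.
Qed.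

Lemma rowdeg_mulmx_le a b c d (X : 'M[{poly F}]_(a, b)) (N : 'M_(b, c)) i :
  (forall j, (rowdeg N j <= d)%N) -> (rowdeg (X *m N) i <= rowdeg X i + d)%N.
Proof.
move=> degN; apply/rowdeg_leP => j; rewrite mxE.
apply: (leq_trans (size_sum _ _ _)); apply/bigmax_leqP => l _.
apply: (leq_trans (size_polyMleq _ _)).
have /rowdeg_leP/(_ l) szX := leqnn (rowdeg X i).
have /rowdeg_leP/(_ j) szN := degN l.
by rewrite -subn1 leq_subLR add1n -addSn -addnS leq_add.
Qed.

(* Predictable degree property of a row reduced matrix with all row degrees [d]. *)
Lemma rowdeg_mulmx_ge a b c d (X : 'M[{poly F}]_(a, b)) (N : 'M_(b, c)) i :
  (forall j, (rowdeg N j <= d)%N) -> row_free (coef_mx d N) ->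
  row i X != 0 -> (rowdeg X i + d <= rowdeg (X *m N) i)%N.
Proof.
move=> degN freeN /rowdeg_coef[l nz_l]; set e := rowdeg X i in nz_l *.
(* The coefficients of degree [e + d] in row [i] of the product form [x *m coef_mx d N], nonzero
   because [x] is. *)
pose x : 'rV[F]_b := \row_j (X i j)`_e.
have : x *m coef_mx d N != 0.
  rewrite mulmx_free_eq0 //; apply: contra nz_l => /eqP/rowP/(_ l).
  by rewrite !mxE => ->.
have [[j nz_j] _|z] := altP (@existsP _ (fun j => (x *m coef_mx d N) 0 j != 0)).
  apply: (@rowdeg_geP _ _ _ _ _ j); rewrite mxE coef_sum.
  move: nz_j; rewrite mxE; congr (_ != 0); apply: eq_bigr => k _.
  rewrite !mxE coefM_top //.
    by have /rowdeg_leP := leqnn e; apply.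
  by have /rowdeg_leP := degN k; apply.
by case/eqP; apply/rowP => j; rewrite [RHS]mxE; apply/eqP; rewrite -[_ == _]negbK;
  apply: contra z => nz; apply/existsP; exists j.
Qed.

Lemma rowdeg_mulmx a b c d (X : 'M[{poly F}]_(a, b)) (N : 'M_(b, c)) i :
  (forall j, (rowdeg N j <= d)%N) -> row_free (coef_mx d N) ->
  row i X != 0 -> rowdeg (X *m N) i = (rowdeg X i + d)%N.
Proof.
move=> degN freeN nzX; apply/eqP.
by rewrite eqn_leq rowdeg_mulmx_le // rowdeg_mulmx_ge.
Qed.

(* If a constant combination of the leading rows vanished, substituting the
   corresponding combination for one of the rows would lower the total degree. *)
Lemma minimal_basis_coef_free a b d (K : 'M[{poly F}]_(a, b)) :
  minimal_basis K -> (forall i, rowdeg K i = d) -> row_free (coef_mx d K).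
Proof.
case=> _ freeK minK degK; rewrite -kermx_eq0; apply/rowV0P => c /sub_kermxP cK0.
apply/rowP => i0; rewrite [RHS]mxE; apply/eqP; apply: contraT => nz_c.
(* The identity with row [i0] replaced by the relation [c], invertible because [c 0 i0] is
   nonzero. *)
pose U : 'M[{poly F}]_a :=
  \matrix_(i, j) if i == i0 then (c 0 j)%:P else (i == j)%:R.
have unitU : frac_mx U \in unitmx.
  rewrite -row_free_unit -kermx_eq0; apply/rowV0P => v /sub_kermxP vU0.
  have vE j : v 0 i0 * pfrac (c 0 j)%:P + (if j == i0 then 0 else v 0 j) = 0.
    have /rowP/(_ j) := vU0; rewrite !mxE (bigD1 i0) //= !mxE eqxx => vj.
    rewrite -[RHS]vj.
    congr (_ + _); case: eqVneq => [->|ne].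
      by rewrite big1 // => k ne; rewrite !mxE (negPf ne) rmorph0 mulr0.
    rewrite (bigD1 j) //= !mxE (negPf ne) eqxx rmorph1 mulr1 big1 ?addr0 // => k.
    by case/andP=> k0 kj; rewrite !mxE (negPf k0) (negPf kj) rmorph0 mulr0.
  have v0 : v 0 i0 = 0.
    have := vE i0; rewrite eqxx addr0 => /eqP.
    by rewrite mulf_eq0 pfrac_eq0 polyC_eq0 (negPf nz_c) orbF => /eqP.
  apply/rowP => j; rewrite [RHS]mxE; have := vE j.
  by rewrite v0 mul0r add0r; case: eqVneq => [->|].
have freeUK : row_free (frac_mx (U *m K)).
  by rewrite /row_free frac_mxM mxrankMfree // mxrank_unit.
have eqUK : (frac_mx (U *m K) == frac_mx K)%MS.
  by apply/eqmxP; rewrite frac_mxM; apply: eqmxMfull; rewrite row_full_unit.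
(* The coefficient of degree [d] is an entry of [c *m coef_mx d K], hence zero. *)
have szUK j : (size ((U *m K) i0 j) <= d)%N.
  apply/leq_sizeP => l; rewrite leq_eqVlt => /orP[/eqP <-|lt_dl]; last first.
    suff /rowdeg_leP/(_ j)/leq_sizeP : (rowdeg (U *m K) i0 <= d)%N by exact.
    rewrite -[d]add0n; apply: leq_trans (rowdeg_mulmx_le _ _ (d := d) _) _ => [k|].
      by rewrite degK.
    rewrite leq_add2r; apply/rowdeg_leP => k; rewrite mxE eqxx.
    by rewrite size_polyC; case: eqP.
  have /rowP/(_ j) := cK0; rewrite !mxE coef_sum => cj; rewrite -[RHS]cj.
  by apply: eq_bigr => k _; rewrite !mxE eqxx coefCM.
(* For [d = 0] no degree can drop; instead row [i0] of [U *m K] is zero, against row freeness. *)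
case: d degK szUK cK0 => [|d] degK szUK _.
  case/eqP: (row_free_row_neq0 i0 freeUK); apply/rowP => j; rewrite !mxE.
  apply/eqP; rewrite pfrac_eq0 -size_poly_eq0 -leqn0.
  by have := szUK j; rewrite mxE.
have := minK _ freeUK eqUK; rewrite leqNgt => /negP[].
rewrite /totdeg (bigD1 i0) //= [X in (_ < X)%N](bigD1 i0) //= -addSn leq_add //.
  by rewrite degK ltnS; apply/rowdeg_leP.
apply: leq_sum => i ne_i; apply/eq_leq; apply: eq_bigr => j _.
congr pdeg; rewrite mxE (bigD1 i) //= mxE (negPf ne_i) eqxx mul1r big1 ?addr0 //.
by move=> k ne_k; rewrite mxE (negPf ne_i) eq_sym (negPf ne_k) mul0r.
Qed.

Lemma rowdeg_const_pmx a b (K : 'M[F]_(a, b)) i : (rowdeg (const_pmx K) i <= 0)%N.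
Proof. by apply/rowdeg_leP => j; rewrite mxE size_polyC; case: eqP. Qed.

Lemma rowdeg_eq0 a b (K : 'M[{poly F}]_(a, b)) i : row i K = 0 -> rowdeg K i = 0%N.
Proof.
move=> /rowP Ki0; apply/eqP; rewrite -leqn0; apply/rowdeg_leP => j.
by have := Ki0 j; rewrite !mxE => ->; rewrite size_poly0.
Qed.

Lemma rowdeg_row_mx a b c (K : 'M[{poly F}]_(a, b)) (N : 'M_(a, c)) i :
  rowdeg (row_mx K N) i = maxn (rowdeg K i) (rowdeg N i).
Proof.
rewrite /rowdeg big_split_ord /=.
by congr maxn; apply: eq_bigr => j _; rewrite ?row_mxEl ?row_mxEr.
Qed.
End FracMx.

(** * Minimal bases under a degree-shifting linear map *)

(* Polynomial bases of [V] and of [V *m Phi] correspond under [Y |-> Y Phi];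
   since all degrees are shifted by the same [d], so do the minimal ones. *)
Lemma minimal_basis_transfer (F : fieldType) (q1 q2 k m b d : nat)
    (V : 'M[ratf F]_(q1, m)) (W : 'M[ratf F]_(q2, b))
    (Phi : 'M[ratf F]_(m, b)) (Psi : 'M[{poly F}]_(b, m)) :
  Phi *m frac_mx Psi = 1%:M -> (W :=: V *m Phi)%MS -> (\rank V < m)%N ->
  (forall Y : 'M[{poly F}]_(k, m), (frac_mx Y <= V)%MS ->
     exists Z, frac_mx Z = frac_mx Y *m Phi) ->
  (forall (Y : 'M[{poly F}]_(k, m)) (Z : 'M[{poly F}]_(k, b)),
     row_free (frac_mx Y) -> (frac_mx Y <= V)%MS ->
     frac_mx Z = frac_mx Y *m Phi -> totdeg Z = (totdeg Y + k * d)%N) ->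
  forall Z : 'M[{poly F}]_(k, b),
    minimal_basis Z /\ (frac_mx Z == W)%MS <->
    exists Y, [/\ minimal_basis Y, (frac_mx Y == V)%MS &
                  frac_mx Z = frac_mx Y *m Phi].
Proof.
move=> PhiK eqW rankV lift degPhi Z.
have freePhi : row_free Phi by apply/row_freeP; exists (frac_mx Psi).
have le_mb : (m <= b)%N.
  by move/eqnP: freePhi => rPhi; rewrite -[X in (X <= _)%N]rPhi rank_leq_col.
have lt_km (Y : 'M[{poly F}]_(k, m)) :
    row_free (frac_mx Y) -> (frac_mx Y == V)%MS -> (k < m)%N.
  by move=> /eqnP rankY /eqmx_rank eqYV; rewrite -[X in (X < _)%N]rankY eqYV.
(* Rows in [W] have the form [E *m V *m Phi], so [Psi] recovers their coordinates, and these stay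
   polynomial. *)
have unlift (X : 'M[{poly F}]_(k, b)) :
    (frac_mx X <= W)%MS -> frac_mx X = frac_mx (X *m Psi) *m Phi.
  rewrite eqW frac_mxM => /submxP[E ->].
  by rewrite !mulmxA -[E *m V *m Phi *m _]mulmxA PhiK mulmx1.
have free_lift (X : 'M[{poly F}]_(k, b)) (Y : 'M[{poly F}]_(k, m)) :
    frac_mx X = frac_mx Y *m Phi -> row_free (frac_mx X) = row_free (frac_mx Y).
  by rewrite /row_free => ->; rewrite mxrankMfree.
have eq_lift (X : 'M[{poly F}]_(k, b)) (Y : 'M[{poly F}]_(k, m)) :
    frac_mx X = frac_mx Y *m Phi -> (frac_mx X == W)%MS = (frac_mx Y == V)%MS.
  by move=> ->; rewrite !eqW !submxMfree.
split=> [[[lt_kb freeZ minZ] eqZ]|[Y [[_ freeY minY] eqY ZE]]].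
  have ZE : frac_mx Z = frac_mx (Z *m Psi) *m Phi.
    by apply: unlift; case/andP: eqZ.
  have freeY : row_free (frac_mx (Z *m Psi)) by rewrite -(free_lift _ _ ZE).
  have eqY : (frac_mx (Z *m Psi) == V)%MS by rewrite -(eq_lift _ _ ZE).
  exists (Z *m Psi); split=> //; split=> [|//|Y' freeY' eqY'].
    exact: lt_km freeY eqY.
  have eqY'V : (frac_mx Y' == V)%MS.
    by apply/eqmxP/(eqmx_trans (eqmxP eqY'))/eqmxP.
  have [sYV _] := andP eqY; have [sY'V _] := andP eqY'V.
  (* A competitor of [Z *m Psi] lifts to a competitor of [Z]; the common shift [k * d] then
     cancels. *)
  have [Z' Z'E] := lift Y' sY'V.
  have: (totdeg Z <= totdeg Z')%N.
    apply: minZ; first by rewrite (free_lift _ _ Z'E).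
    by rewrite ZE Z'E !submxMfree.
  by rewrite (degPhi _ _ freeY sYV ZE) (degPhi _ _ freeY' sY'V Z'E) leq_add2r.
have freeZ : row_free (frac_mx Z) by rewrite (free_lift _ _ ZE).
have eqZ : (frac_mx Z == W)%MS by rewrite (eq_lift _ _ ZE).
split=> //; split=> [|//|Z' freeZ' eqZ'].
  exact: leq_trans (lt_km Y freeY eqY) le_mb.
have Z'E : frac_mx Z' = frac_mx (Z' *m Psi) *m Phi.
  apply: unlift; have/andP[sZ _] := eqZ; apply: submx_trans sZ.
  by case/andP: eqZ'.
have freeY' : row_free (frac_mx (Z' *m Psi)) by rewrite -(free_lift _ _ Z'E).
have eqY' : (frac_mx (Z' *m Psi) == frac_mx Y)%MS.
  by move: eqZ'; rewrite ZE {1 2}Z'E !submxMfree.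
have [sYV _] := andP eqY.
have sY'V : (frac_mx (Z' *m Psi) <= V)%MS.
  by apply: submx_trans sYV; case/andP: eqY'.
rewrite (degPhi _ _ freeY sYV ZE) (degPhi _ _ freeY' sY'V Z'E) leq_add2r.
exact: minY.
Qed.

(** * The pencil lambda I - A and its adjugate *)

Section Pencil.
Variables (F : fieldType) (n : nat) (A : 'M[F]_n).

Lemma pencilA_det : \det (pencilA A) = char_poly A.
Proof. by []. Qed.

Lemma char_poly_neq0 : char_poly A != 0.
Proof. exact: monic_neq0 (char_poly_monic A). Qed.

Lemma pencilA_unit : frac_mx (pencilA A) \in unitmx.
Proof.
by rewrite unitmxE det_map_mx unitfE pfrac_eq0 pencilA_det char_poly_neq0.
Qed.

Lemma pencilA_tr : pencilA A^T = (pencilA A)^T.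
Proof. by rewrite /pencilA const_pmx_tr linearB /= tr_scalar_mx. Qed.

(** Cramer's rule: the characteristic polynomial is a common denominator of the resolvent, which
    brings questions on it back to polynomials. *)
Lemma pencilA_inv :
  pfrac (char_poly A) *: invmx (frac_mx (pencilA A)) =
  frac_mx (\adj (pencilA A)).
Proof.
rewrite -[LHS](mulKmx pencilA_unit) -scalemxAr mulmxV ?pencilA_unit //.
rewrite scalemx1 -[RHS](mulKmx pencilA_unit) -frac_mxM mul_mx_adj pencilA_det.
by congr (_ *m _); rewrite /frac_mx map_scalar_mx.
Qed.

Lemma rowdeg_pencilA (S : 'M[F]_n) i :
  (rowdeg (const_pmx S *m pencilA A) i <= 1)%N.
Proof.
rewrite -[X in (_ <= X)%N]add0n.
apply: leq_trans (rowdeg_mulmx_le _ _ (d := 1) _) _ => [j|].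
  apply/rowdeg_leP => l; rewrite !mxE (leq_trans (size_polyD _ _)) //.
  rewrite geq_max size_polyN size_polyC.
  by case: (A j l == 0); case: (j == l);
     rewrite ?mulr1n ?mulr0n ?size_polyX ?size_poly0.
by rewrite leq_add2r; exact: rowdeg_const_pmx.
Qed.

Lemma coef_pencilA (S : 'M[F]_n) : coef_mx 1 (const_pmx S *m pencilA A) = S.
Proof.
rewrite mulmxBr mul_mx_scalar -const_pmxM; apply/matrixP => i j.
by rewrite !mxE coefB coefXM !coefC /= subr0.
Qed.

(** The leading coefficient matrix of S (lambda I - A) is the invertible [S], so the predictable
    degree property applies. *)
Lemma rowdeg_mul_pencilA a (S : 'M[F]_n) (X : 'M[{poly F}]_(a, n)) i :
  S \in unitmx -> row i X != 0 ->
  rowdeg (X *m (const_pmx S *m pencilA A)) i = (rowdeg X i).+1.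
Proof.
move=> unitS nzX; rewrite -addn1; apply: rowdeg_mulmx => //.
  exact: rowdeg_pencilA.
by rewrite coef_pencilA row_free_unit.
Qed.

(** Multiplying the adjugate by the pencil gives the characteristic polynomial, of degree [n], on
    the diagonal, and raises the degree of a nonzero row by one. This avoids expanding cofactors. *)
Lemma size_adj_pencilA i j : (size (\adj (pencilA A) i j) <= n)%N.
Proof.
have [/rowP/(_ j)|nz] := eqVneq (row i (\adj (pencilA A))) 0.
  by rewrite [LHS]mxE [RHS]mxE => ->; rewrite size_poly0.
have := rowdeg_mul_pencilA (unitmx1 F n) nz.
rewrite const_pmx1 mul1mx mul_adj_mx pencilA_det => degE.
have : ((rowdeg (\adj (pencilA A)) i).+1 <= n)%N.
  rewrite -degE; apply/rowdeg_leP => l; rewrite mxE.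
  by case: (i == l); rewrite ?mulr1n ?mulr0n ?size_poly0 ?size_char_poly.
move=> lt_n; have /rowdeg_leP/(_ j)/leq_trans : (rowdeg (\adj (pencilA A)) i <= n.-1)%N.
  by rewrite -ltnS (ltn_predK lt_n).
by apply; rewrite (ltn_predK lt_n).
Qed.

End Pencil.

(* [C (lambda I - A)^-1 B] is strictly proper, hence cannot cancel [D]. *)
Lemma poly_add_transfer_neq0 (F : fieldType) (p m n : nat)
    (D : 'M[{poly F}]_(p, m)) (C : 'M[F]_(p, n)) (A : 'M[F]_n) (B : 'M[F]_(n, m)) :
  D != 0 -> frac_mx D + transfer C A B != 0.
Proof.
apply: contraNneq => /(congr1 ( *:%R (pfrac (char_poly A)))) /eqP.
rewrite scaler0 scalerDr -frac_mxZ /transfer scalemxAl scalemxAr pencilA_inv.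
rewrite -!frac_mxM -frac_mxD -[X in _ == X]frac_mx0.
move=> /eqP/frac_mx_inj/eqP; rewrite addr_eq0 => /eqP/matrixP eqD.
apply/eqP/matrixP => i j; rewrite [RHS]mxE; apply/eqP; rewrite -size_poly_eq0.
have := congr1 (fun q : {poly F} => size q) (eqD i j); rewrite mxE [in RHS]mxE.
have [->|nzD] := eqVneq (D i j) 0; first by rewrite size_poly0.
rewrite size_polyN size_mul ?char_poly_neq0 // size_char_poly addSn /= => szE.
(* The left side is the size of the characteristic polynomial times [D i j]; the right side bounds
   the entries of C adj(lambda I - A) B. *)
suff : (n + size (D i j) <= n)%N by rewrite -[X in (_ <= X)%N]addn0 leq_add2l leqn0.
rewrite szE mxE; apply: (leq_trans (size_sum _ _ _)); apply/bigmax_leqP => l _.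
rewrite [const_pmx B _ _]mxE mulrC mul_polyC (leq_trans (size_scale_leq _ _)) //.
rewrite mxE; apply: (leq_trans (size_sum _ _ _)); apply/bigmax_leqP => h _.
rewrite mxE mul_polyC (leq_trans (size_scale_leq _ _)) //.
exact: size_adj_pencilA.
Qed.

(** * Duality and minimality of realizations *)

Lemma transfer_tr (F : fieldType) (p m n : nat)
    (C : 'M[F]_(p, n)) (A : 'M[F]_n) (B : 'M[F]_(n, m)) :
  transfer B^T A^T C^T = (transfer C A B)^T.
Proof.
by rewrite /transfer pencilA_tr !const_pmx_tr !frac_mx_tr !trmx_mul trmx_inv mulmxA.
Qed.

Lemma transferN (F : fieldType) (p m n : nat)
    (C : 'M[F]_(p, n)) (A : 'M[F]_n) (B : 'M[F]_(n, m)) :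
  transfer (- C) A (- B) = transfer C A B.
Proof.
by rewrite /transfer !const_pmxN !frac_mxN mulmxN !mulNmx opprK.
Qed.

(** Transposing a realization keeps its order, and the two signs cancel. They are the signs that
    appear in the transpose of L. *)
Lemma minimal_order_realization_tr (F : fieldType) (p m n : nat)
    (C : 'M[F]_(p, n)) (A : 'M[F]_n) (B : 'M[F]_(n, m)) :
  minimal_order_realization C A B ->
  minimal_order_realization (- B^T) A^T (- C^T).
Proof.
move=> minABC n' C' A' B' eqG; apply: (minABC n' B'^T A'^T C'^T).
by rewrite transfer_tr eqG transferN transfer_tr trmxK.
Qed.

(* Compressing a realization to an [A]-invariant space [V] of row vectors
   containing the rows of [C] does not change the transfer function. *)
Lemma minimal_order_row_full (F : fieldType) (p m n : nat)
    (C : 'M[F]_(p, n)) (A : 'M[F]_n) (B : 'M[F]_(n, m)) q (V : 'M[F]_(q, n)) :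
  minimal_order_realization C A B ->
  (C <= V)%MS -> (V *m A <= V)%MS -> row_full V.
Proof.
move=> minABC sCV sVAV; rewrite -col_leq_rank.
have eqW := eq_row_base V; move: (row_base V) eqW => W eqW.
have [C' CE] : exists C', C = C' *m W by apply/submxP; rewrite eqW.
have [A' AE] : exists A', W *m A = A' *m W.
  by apply/submxP; rewrite eqW (eqmxMr _ eqW).
apply: (minABC _ C' A' (W *m B)).
(* This intertwining passes to the inverses, so the compressed system, of order the rank of [V], has
   the same transfer function. *)
have PE : const_pmx W *m pencilA A = pencilA A' *m const_pmx W.
  by rewrite mulmxBr mulmxBl -!const_pmxM AE mul_mx_scalar mul_scalar_mx.
rewrite /transfer CE !const_pmxM !frac_mxM !mulmxA; congr (_ *m _).
rewrite -!mulmxA; congr (_ *m _).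
rewrite -[LHS](mulmxK (pencilA_unit A)); congr (_ *m _).
by rewrite -!mulmxA -frac_mxM PE frac_mxM mulKmx ?pencilA_unit.
Qed.

(* For [x] rational with [(lambda I - A) x] and [C x] polynomial, the constant
   rows [v] with [v x] polynomial form an [A]-invariant space containing the
   rows of [C], because [v A x = lambda v x - v (lambda I - A) x]. *)
Lemma minimal_order_dvdp (F : fieldType) (p m n : nat)
    (C : 'M[F]_(p, n)) (A : 'M[F]_n) (B : 'M[F]_(n, m)) (d : {poly F})
    (y u : 'cV[{poly F}]_n) (w : 'cV[{poly F}]_p) :
  minimal_order_realization C A B -> d != 0 ->
  pencilA A *m y = d *: u -> const_pmx C *m y = d *: w ->
  forall i, d %| y i 0.
Proof.
move=> minABC nz_d PyE CyE.
(* With x = y / d, v x is polynomial iff [d] divides v y. Reduction modulo [d] is linear over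
   constants, so this says v Q = 0. *)
pose Q : 'M[F]_(n, size d) := \matrix_(i, j) (y i 0 %% d)`_j.
have dvdE a (v : 'M[F]_(a, n)) i :
    (row i v *m Q == 0) = (d %| (const_pmx v *m y) i 0).
  rewrite /dvdp mxE -[X in _ = (modp X d == 0)]/(\sum_j _).
  have -> : (\sum_j const_pmx v i j * y j 0) %% d =
            \sum_j (v i j)%:P * (y j 0 %% d).
    rewrite (big_morph (fun q => q %% d) (modpD _) (mod0p _)).
    by apply: eq_bigr => j _; rewrite mxE !mul_polyC modpZl.
  have coefE l : (\sum_j (v i j)%:P * (y j 0 %% d))`_l =
                 \sum_j v i j * (y j 0 %% d)`_l.
    by rewrite coef_sum; apply: eq_bigr => j _; rewrite coefCM.
  apply/eqP/eqP => [/rowP vQ0|z].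
    apply/polyP => l; rewrite coefE coef0; have [lt_l|le_l] := ltnP l (size d).
      have := vQ0 (Ordinal lt_l); rewrite !mxE => vl; rewrite -[RHS]vl.
      by apply: eq_bigr => j _; rewrite !mxE.
    rewrite big1 // => j _; rewrite nth_default ?mulr0 //.
    by rewrite (leq_trans _ le_l) // ltnW // ltn_modp.
  apply/rowP => l; rewrite [RHS]mxE -[RHS](coef0 F l) -z coefE mxE.
  by apply: eq_bigr => j _; rewrite !mxE.
have kerE a (v : 'M[F]_(a, n)) :
    (forall i, d %| (const_pmx v *m y) i 0) -> (v <= kermx Q)%MS.
  by move=> dv; apply/sub_kermxP/row_matrixP => i; rewrite row_mul row0; apply/eqP;
     rewrite dvdE.
have fullQ : row_full (kermx Q).
  apply: (minimal_order_row_full minABC).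
    by apply: kerE => i; rewrite CyE mxE dvdp_mulr.
  apply: kerE => i; rewrite const_pmxM -mulmxA.
  have -> : const_pmx A *m y = 'X *: y - d *: u.
    by rewrite -PyE mulmxBl mul_scalar_mx opprB addrC subrK.
  have dvd_ker : d %| (const_pmx (kermx Q) *m y) i 0.
    by rewrite -dvdE -row_mul mulmx_ker row0.
  rewrite mulmxBr -!scalemxAr mxE [X in X + _]mxE [X in _ + X]mxE [X in - X]mxE.
  by apply: dvdp_sub; [apply: dvdp_mull | apply: dvdp_mulr].
move=> i; suff -> : y i 0 = (const_pmx 1%:M *m y) i 0.
  by rewrite -dvdE -row_mul mul1mx; have /sub_kermxP := submx_full 1%:M fullQ;
     rewrite mul1mx => ->; rewrite row0.
by rewrite const_pmx1 mul1mx.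
Qed.

(** * The null space of the block matrix *)

Lemma mul_col_row_eq1 (R : comNzRingType) (a1 a2 b : nat)
    (K : 'M[R]_(a1, b)) (Kh : 'M[R]_(a2, b)) (Nh : 'M[R]_(b, a1)) (N : 'M[R]_(b, a2)) :
  col_mx K Kh *m row_mx Nh N = 1%:M ->
  [/\ K *m Nh = 1%:M, K *m N = 0, Kh *m Nh = 0 & Kh *m N = 1%:M].
Proof. by rewrite mul_col_row scalar_mx_block => /eq_block_mx. Qed.

(** Stated over any field, with [P] for lambda I - A, so that the kernel computation is pure block
    algebra. *)
Definition lin_kernel_map (E : fieldType) (p m n ph mh : nat)
    (S P : 'M[E]_n) (B : 'M[E]_(n, m)) (M : 'M[E]_(p + ph, m + mh))
    (N1 : 'M[E]_(m, m + mh)) (N2h : 'M[E]_(ph, p + ph)) :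
    'M[E]_(n + ((m + mh) + ph), m) :=
  col_mx (- (invmx S *m invmx P *m B)) (col_mx N1^T (- (N2h *m M *m N1^T))).

(** Put y = K1h z2. The third block row, K1 z2 = 0, gives z2 = N1^T y, and the first then gives z1.
    Multiplying the second by [N2] eliminates z3 and leaves G y = 0; multiplying it by [N2h]
    eliminates z1 and yields z3. *)
Lemma lin_kernelP (E : fieldType) (p m n ph mh k : nat)
    (T S P : 'M[E]_n) (B : 'M[E]_(n, m)) (C : 'M[E]_(p, n))
    (M : 'M[E]_(p + ph, m + mh))
    (K1 N1h : 'M[E]_(mh, m + mh)) (K2 N2h : 'M[E]_(ph, p + ph))
    (K1h N1 : 'M[E]_(m, m + mh)) (K2h N2 : 'M[E]_(p, p + ph))
    (z : 'M[E]_(n + ((m + mh) + ph), k)) :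
  col_mx K1 K1h *m row_mx N1h^T N1^T = 1%:M ->
  row_mx N1h^T N1^T *m col_mx K1 K1h = 1%:M ->
  col_mx K2 K2h *m row_mx N2h^T N2^T = 1%:M ->
  row_mx N2h^T N2^T *m col_mx K2 K2h = 1%:M ->
  T \in unitmx -> S \in unitmx -> P \in unitmx ->
  col_mx (row_mx (T *m P *m S) (row_mx (T *m B *m K1h) 0))
    (col_mx (row_mx (- (K2h^T *m C *m S)) (row_mx M K2^T))
            (row_mx 0 (row_mx K1 0))) *m z = 0 <->
  exists2 y : 'M[E]_(m, k),
    (N2 *m M *m N1^T + C *m invmx P *m B) *m y = 0 &
    z = lin_kernel_map S P B M N1 N2h *m y.
Proof.
move=> /mul_col_row_eq1[_ K1N1 _ K1hN1] inv1.
move=> /mul_col_row_eq1[K2N2h K2N2 K2hN2h K2hN2] inv2 unitT unitS unitP.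
have {}inv1 : N1h^T *m K1 + N1^T *m K1h = 1%:M by rewrite -mul_row_col.
have {}inv2 : K2^T *m N2h + K2h^T *m N2 = 1%:M.
  apply: trmx_inj; rewrite linearD /= !trmx_mul !trmxK tr_scalar_mx.
  by rewrite -mul_row_col.
have /(congr1 trmx) := K2N2h; rewrite trmx_mul trmxK tr_scalar_mx => {}K2N2h.
have /(congr1 trmx) := K2N2; rewrite trmx_mul trmxK trmx0 => {}K2N2.
have /(congr1 trmx) := K2hN2h; rewrite trmx_mul trmxK trmx0 => {}K2hN2h.
have /(congr1 trmx) := K2hN2; rewrite trmx_mul trmxK tr_scalar_mx => {}K2hN2.
rewrite -[z]vsubmxK; move: (usubmx z) (dsubmx z) => z1 z23.
rewrite -[z23]vsubmxK; move: (usubmx z23) (dsubmx z23) => z2 z3.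
rewrite /lin_kernel_map !mul_col_mx !mul_row_col !mul0mx !add0r !addr0 !mulNmx.
split=> [/eqP|[y Gy0]]; last first.
  rewrite !mul_col_mx !mulNmx => /eq_col_mx[-> /eq_col_mx[-> ->]].
  rewrite !mulmxN -!mulmxA.
  rewrite [S *m (invmx S *m _)]mulKVmx // [P *m (invmx P *m _)]mulKVmx //.
  rewrite [K1h *m (_ *m _)]mulmxA K1hN1 mul1mx addNr opprK.
  rewrite [K1 *m (_ *m _)]mulmxA K1N1 mul0mx.
  suff -> : K2h^T *m (C *m (invmx P *m (B *m y))) +
            (M *m (N1^T *m y) - K2^T *m (N2h *m (M *m (N1^T *m y)))) = 0.
    by rewrite !col_mx0.
  (* Splitting M N1^T y by [inv2], the K2^T part cancels the third block and the rest is K2h^T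
     applied to G y. *)
  rewrite -[X in X - _]mul1mx -inv2 mulmxDl -!mulmxA addrAC subrr add0r -mulmxDr.
  by move: Gy0; rewrite mulmxDl -!mulmxA addrC => ->; rewrite mulmx0.
rewrite !col_mx_eq0 => /and3P[/eqP eq1 /eqP eq2 /eqP eq3].
have z2E : z2 = N1^T *m (K1h *m z2).
  by rewrite -[LHS]mul1mx -inv1 mulmxDl -!mulmxA eq3 mulmx0 add0r.
have z1E : S *m z1 = - (invmx P *m (B *m (K1h *m z2))).
  apply: (can_inj (mulKmx unitP)); apply: (can_inj (mulKmx unitT)).
  rewrite !mulmxN mulKVmx // !mulmxA; apply/eqP.
  by rewrite -addr_eq0 eq1.
exists (K1h *m z2).
  have := congr1 (mulmx N2) eq2; rewrite mulmx0 !mulmxDr !mulmxN !mulmxA.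
  rewrite K2hN2 K2N2 mul0mx addr0 mul1mx -mulmxA z1E mulmxN opprK => <-.
  by rewrite !mulmxDl addrC -!mulmxA -z2E.
rewrite !mul_col_mx !mulNmx.
congr col_mx; first by rewrite -[LHS](mulKmx unitS) z1E mulmxN !mulmxA.
congr col_mx; first by [].
have := congr1 (mulmx N2h) eq2; rewrite mulmx0 !mulmxDr !mulmxN !mulmxA.
rewrite K2hN2h K2N2h !mul0mx oppr0 add0r mul1mx addrC => /eqP.
by rewrite addr_eq0 => /eqP ->; rewrite -!mulmxA -z2E.
Qed.

(** * Right minimal bases *)

(** For x = (lambda I - A)^-1 B H, both (lambda I - A) x = B H and C x = - D H are polynomial, so
    [minimal_order_dvdp] applies to each column, with the characteristic polynomial as
    denominator. *)
Lemma minimal_order_poly (F : fieldType) (p m n k : nat)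
    (C : 'M[F]_(p, n)) (A : 'M[F]_n) (B : 'M[F]_(n, m))
    (D : 'M[{poly F}]_(p, m)) (H : 'M[{poly F}]_(m, k)) :
  minimal_order_realization C A B ->
  (frac_mx D + transfer C A B) *m frac_mx H = 0 ->
  exists z : 'M[{poly F}]_(n, k),
    frac_mx z = invmx (frac_mx (pencilA A)) *m frac_mx (const_pmx B) *m frac_mx H.
Proof.
move=> minABC GH0; pose d := char_poly A.
pose y := \adj (pencilA A) *m const_pmx B *m H.
have PyE : pencilA A *m y = d *: (const_pmx B *m H).
  by rewrite /y !mulmxA mul_mx_adj pencilA_det mul_scalar_mx scalemxAl.
have yE : frac_mx y = pfrac d *:
    (invmx (frac_mx (pencilA A)) *m frac_mx (const_pmx B) *m frac_mx H).
  by rewrite /y !frac_mxM -pencilA_inv -!scalemxAl.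
have CyE : const_pmx C *m y = d *: (- (D *m H)).
  apply: frac_mx_inj; rewrite frac_mxM yE frac_mxZ frac_mxN frac_mxM.
  rewrite -scalemxAr; congr (_ *: _); apply/eqP; rewrite -addr_eq0 addrC.
  by rewrite -GH0 /transfer mulmxDl !mulmxA.
have dvd_y i j : d %| y i j.
  have := @minimal_order_dvdp _ _ _ _ C A B d (col j y)
    (col j (const_pmx B *m H)) (col j (- (D *m H))) minABC (char_poly_neq0 A) _ _ i.
  rewrite [col j y i 0]mxE; apply.
    by rewrite !colE mulmxA PyE -scalemxAl.
  by rewrite !colE mulmxA CyE -scalemxAl.
exists (\matrix_(i, j) (y i j %/ d)).
apply: (@scalerI _ _ (pfrac d)); first by rewrite pfrac_eq0 char_poly_neq0.
rewrite -yE -frac_mxZ; congr frac_mx; apply/matrixP => i j.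
by rewrite [LHS]mxE [X in _ * X]mxE mulrC divpK.
Qed.

(** An instance of [minimal_basis_transfer], transposed because [kermx] is a left kernel: [V] and
    [W] are the kernels of G^T and L^T, and the shift is deg N1. *)
Lemma right_minimal_basis_sbmb_lin (F : fieldType) (p m n ph mh k : nat)
    (D : 'M[{poly F}]_(p, m)) (A : 'M[F]_n) (B : 'M[F]_(n, m)) (C : 'M[F]_(p, n))
    (K1 : 'M[{poly F}]_(mh, m + mh)) (K2 : 'M[{poly F}]_(ph, p + ph))
    (N1 : 'M[{poly F}]_(m, m + mh)) (N2 : 'M[{poly F}]_(p, p + ph))
    (M : 'M[{poly F}]_(p + ph, m + mh))
    (K1h : 'M[F]_(m, m + mh)) (K2h : 'M[F]_(p, p + ph))
    (N1h : 'M[{poly F}]_(mh, m + mh)) (N2h : 'M[{poly F}]_(ph, p + ph))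
    (T S : 'M[F]_n)
    (H1 : 'M[{poly F}]_(n, k)) (H2 : 'M[{poly F}]_(m + mh, k))
    (H3 : 'M[{poly F}]_(ph, k)) :
  minimal_order_realization C A B -> D != 0 ->
  minimal_basis K2 -> (forall i, rowdeg K2 i = 1%N) ->
  minimal_basis N1 -> (forall i j, rowdeg N1 i = rowdeg N1 j) ->
  is_pencil M -> D = N2 *m M *m N1^T ->
  col_mx K1 (const_pmx K1h) *m row_mx N1h^T N1^T = 1%:M ->
  row_mx N1h^T N1^T *m col_mx K1 (const_pmx K1h) = 1%:M ->
  col_mx K2 (const_pmx K2h) *m row_mx N2h^T N2^T = 1%:M ->
  row_mx N2h^T N2^T *m col_mx K2 (const_pmx K2h) = 1%:M ->
  T \in unitmx -> S \in unitmx ->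
  right_minimal_basis (frac_mx (sbmb_lin T S A B C M K1 K2 K1h K2h))
    (col_mx H1 (col_mx H2 H3)) <->
  exists H : 'M[{poly F}]_(m, k),
    [/\ right_minimal_basis (frac_mx D + transfer C A B) H,
        frac_mx H1 = - (frac_mx (const_pmx (invmx S)) *m
                        invmx (frac_mx (pencilA A)) *m
                        frac_mx (const_pmx B) *m frac_mx H),
        H2 = N1^T *m H &
        H3 = - (N2h *m M *m N1^T *m H)].
Proof.
move=> minABC nzD minK2 degK2 minN1 degN1 penM DE inv1 inv1' inv2 inv2' unitT unitS.
set G := frac_mx D + _.
set L := frac_mx _.
pose Phi := lin_kernel_map (frac_mx (const_pmx S)) (frac_mx (pencilA A))
  (frac_mx (const_pmx B)) (frac_mx M) (frac_mx N1) (frac_mx N2h).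
have invS : frac_mx (const_pmx (invmx S)) = invmx (frac_mx (const_pmx S)).
  by rewrite /frac_mx /const_pmx -!map_mx_comp -map_invmx.
have fracS : frac_mx (const_pmx S) \in unitmx.
  by rewrite /frac_mx /const_pmx -map_mx_comp map_unitmx.
have fracT : frac_mx (const_pmx T) \in unitmx.
  by rewrite /frac_mx /const_pmx -map_mx_comp map_unitmx.
have kerL q (z : 'M[ratf F]_(_, q)) :
    L *m z = 0 <-> exists2 y, G *m y = 0 & z = Phi *m y.
  have frac_inv (a1 a2 b : nat) (K : 'M[{poly F}]_(a1, b)) (Kh : 'M_(a2, b)) Nh N :
      col_mx K Kh *m row_mx Nh^T N^T = 1%:M ->
      col_mx (frac_mx K) (frac_mx Kh) *m row_mx (frac_mx Nh)^T (frac_mx N)^T = 1%:M.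
    move/(congr1 (@frac_mx _ _ _)).
    by rewrite frac_mxM frac_mx_col frac_mx_row !frac_mx_tr frac_mx1.
  have frac_inv' (a1 a2 b : nat) (K : 'M[{poly F}]_(a1, b)) (Kh : 'M_(a2, b)) Nh N :
      row_mx Nh^T N^T *m col_mx K Kh = 1%:M ->
      row_mx (frac_mx Nh)^T (frac_mx N)^T *m col_mx (frac_mx K) (frac_mx Kh) = 1%:M.
    move/(congr1 (@frac_mx _ _ _)).
    by rewrite frac_mxM frac_mx_col frac_mx_row !frac_mx_tr frac_mx1.
  have := lin_kernelP (frac_mx (const_pmx B)) (frac_mx (const_pmx C))
    (frac_mx M) z (frac_inv _ _ _ _ _ _ _ inv1) (frac_inv' _ _ _ _ _ _ _ inv1')
    (frac_inv _ _ _ _ _ _ _ inv2) (frac_inv' _ _ _ _ _ _ _ inv2')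
    fracT fracS (pencilA_unit A).
  rewrite /L /sbmb_lin !(frac_mx_col, frac_mx_row, frac_mxM, frac_mxN, frac_mx0,
    const_pmxM, const_pmx_tr, frac_mx_tr).
  by rewrite /G DE !(frac_mxM, frac_mx_tr).
have eqW : (kermx L^T :=: kermx G^T *m Phi^T)%MS.
  apply/eqmxP/andP; split; last first.
    apply/sub_kermxP/trmx_inj; rewrite trmx_mul trmxK trmx0.
    apply/kerL; exists (kermx G^T)^T; last by rewrite trmx_mul trmxK.
    by apply: trmx_inj; rewrite trmx_mul trmxK mulmx_ker trmx0.
  have [|y Gy0 zE] := (kerL _ (kermx L^T)^T).1.
    by apply: trmx_inj; rewrite trmx_mul trmxK mulmx_ker trmx0.
  rewrite -[X in (X <= _)%MS]trmxK zE trmx_mul submxMr //.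
  by apply/sub_kermxP; rewrite -trmx_mul Gy0 trmx0.
(* A zero G would have a square kernel basis, which [minimal_basis] excludes; D nonzero rules this
   out. *)
have rankV : (\rank (kermx G^T) < m)%N.
  have nzG : G != 0 by apply: poly_add_transfer_neq0.
  have m_gt0 : (0 < \rank G^T)%N by rewrite mxrank_tr lt0n mxrank_eq0.
  by rewrite mxrank_ker -subn_gt0 subKn // rank_leq_row.
pose Psi : 'M[{poly F}]_(n + ((m + mh) + ph), m) :=
  (row_mx 0 (row_mx (const_pmx K1h) 0))^T.
have PhiK : Phi^T *m frac_mx Psi = 1%:M.
  apply: trmx_inj; rewrite trmx_mul trmxK tr_scalar_mx -frac_mx_tr trmxK.
  rewrite !frac_mx_row !frac_mx0 /Phi /lin_kernel_map !mul_row_col.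
  rewrite !mul0mx add0r addr0 -frac_mx_tr -frac_mxM.
  by have [_ _ _ ->] := mul_col_row_eq1 inv1; rewrite frac_mx1.
have sub_ker (Y : 'M[{poly F}]_(k, m)) :
    (frac_mx Y <= kermx G^T)%MS -> G *m frac_mx Y^T = 0.
  move/sub_kermxP => YG0; apply: trmx_inj.
  by rewrite trmx_mul -frac_mx_tr trmxK YG0 trmx0.
pose d := mxdeg N1.
have degN1d i : rowdeg N1 i = d.
  apply/eqP; rewrite eqn_leq /d /mxdeg leq_bigmax /=.
  by apply/bigmax_leqP => j _; rewrite (degN1 j i).
have lift (Y : 'M[{poly F}]_(k, m)) :
    (frac_mx Y <= kermx G^T)%MS -> exists Z, frac_mx Z = frac_mx Y *m Phi^T.
  move/sub_ker => GY0; have [z zE] := minimal_order_poly minABC GY0.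
  exists (col_mx (- (const_pmx (invmx S) *m z))
           (col_mx (N1^T *m Y^T) (- (N2h *m M *m N1^T *m Y^T))))^T.
  rewrite frac_mx_tr !frac_mx_col !frac_mxN !frac_mxM zE invS.
  apply: trmx_inj; rewrite trmxK trmx_mul trmxK /Phi /lin_kernel_map.
  by rewrite !mul_col_mx !mulNmx !mulmxA !frac_mx_tr.
have degPhi (Y : 'M[{poly F}]_(k, m)) (Z : 'M[{poly F}]_(k, n + ((m + mh) + ph))) :
    row_free (frac_mx Y) -> (frac_mx Y <= kermx G^T)%MS ->
    frac_mx Z = frac_mx Y *m Phi^T -> totdeg Z = (totdeg Y + k * d)%N.
  move=> freeY /sub_ker GY0 ZE.
  have LZ0 : sbmb_lin T S A B C M K1 K2 K1h K2h *m Z^T = 0.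
    apply: frac_mx_inj; rewrite frac_mxM frac_mx0; apply/kerL.
    by exists (frac_mx Y^T) => //; rewrite frac_mx_tr ZE trmx_mul trmxK -frac_mx_tr.
  move: ZE LZ0; rewrite -[Z]hsubmxK; move: (lsubmx Z) (rsubmx Z) => Z1 Z23.
  rewrite -[Z23]hsubmxK; move: (lsubmx Z23) (rsubmx Z23) => Z2 Z3.
  rewrite !tr_row_mx /sbmb_lin !mul_col_mx !mul_row_col !mul0mx !addr0.
  rewrite !frac_mx_row /Phi /lin_kernel_map !tr_col_mx !mul_mx_row.
  move=> /eq_row_mx[_ /eq_row_mx[Z2E _]] /eqP.
  have {}Z2E : Z2 = Y *m N1.
    by apply: frac_mx_inj; rewrite Z2E trmxK frac_mxM.
  rewrite !col_mx_eq0 => /and3P[/eqP eq1 /eqP eq2 _].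
  rewrite /totdeg -[X in (_ + X * d)%N]card_ord -sum_nat_const -big_split /=.
  apply: eq_bigr => i _; rewrite !rowdeg_row_mx.
  have nzY : row i Y != 0.
    apply: contra (row_free_row_neq0 i freeY) => /eqP Yi0.
    by rewrite /frac_mx -map_row Yi0 map_mx0.
  have degZ2 : rowdeg Z2 i = (rowdeg Y i + d)%N.
    rewrite Z2E; apply: rowdeg_mulmx => // [j|]; first by rewrite degN1d.
    exact: minimal_basis_coef_free.
  (* Cancelling T in the first block row gives Z1 S^T (lambda I - A^T) = - Y B^T, so a nonzero row
     of [Z1] has degree even below that of [Y]. *)
  have degZ1 : (rowdeg Z1 i <= rowdeg Y i)%N.
    have [/rowdeg_eq0 -> //|nzZ1] := eqVneq (row i Z1) 0.
    have unitST : S^T \in unitmx by rewrite unitmx_tr.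
    apply: ltnW; rewrite -(rowdeg_mul_pencilA A^T unitST nzZ1).
    have -> : Z1 *m (const_pmx S^T *m pencilA A^T) = Y *m const_pmx (- B^T).
      apply: trmx_inj; rewrite const_pmxN !mulmxN linearN /= !trmx_mul.
      rewrite pencilA_tr !const_pmx_tr !trmxK; apply/eqP; rewrite -addr_eq0.
      have := congr1 (mulmx (const_pmx (invmx T))) eq1.
      rewrite mulmx0 mulmxDr const_pmxM Z2E trmx_mul !mulmxA.
      rewrite !const_pmxM.
      rewrite !mulmxA -!const_pmxM mulVmx // const_pmx1 !mul1mx const_pmxM.
      have [_ _ _ K1hN1] := mul_col_row_eq1 inv1.
      by rewrite -[const_pmx B *m _ *m _]mulmxA K1hN1 mulmx1 => ->.
    rewrite -[X in (_ <= X)%N]addn0; apply: rowdeg_mulmx_le => j.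
    exact: rowdeg_const_pmx.
  (* The second block row writes Z3 K2 as [Z1 Z2] times a matrix of degree at most 1, while K2
     raises the degree of a nonzero row by exactly 1. *)
  have degZ3 : (rowdeg Z3 i <= rowdeg Z2 i)%N.
    have [/rowdeg_eq0 -> //|nzZ3] := eqVneq (row i Z3) 0.
    have -> : rowdeg Z2 i = rowdeg (row_mx Z1 Z2) i.
      rewrite rowdeg_row_mx; apply/esym/maxn_idPr; rewrite degZ2.
      exact: leq_trans degZ1 (leq_addr _ _).
    rewrite -(leq_add2r 1) -(rowdeg_mulmx (N := K2) (d := 1)) //; last first.
    - exact: minimal_basis_coef_free.
    - by move=> j; rewrite degK2.
    have -> : Z3 *m K2 =
        row_mx Z1 Z2 *m col_mx (const_pmx (K2h^T *m C *m S))^T (- M^T).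
      apply: trmx_inj; rewrite mul_row_col mulmxN linearB /= !trmx_mul !trmxK.
      move/eqP: eq2; rewrite mulNmx addrC subr_eq0 => /eqP <-.
      by rewrite [RHS]addrC addKr.
    apply: rowdeg_mulmx_le => j; apply/rowdeg_leP => l.
    rewrite -[j](splitK j); case: (split j) => j' /=.
      rewrite col_mxEu !mxE; apply: leq_trans (_ : 1 <= _)%N => //.
      by rewrite size_polyC; case: eqP.
    by rewrite col_mxEd !mxE size_polyN.
  rewrite (maxn_idPl degZ3) (maxn_idPr _) ?degZ2 //.
  exact: leq_trans degZ1 (leq_addr _ _).
apply: (iff_trans (minimal_basis_transfer PhiK eqW rankV lift degPhi
  (col_mx H1 (col_mx H2 H3))^T)).
have ZE (Y : 'M[{poly F}]_(k, m)) :
    frac_mx (col_mx H1 (col_mx H2 H3))^T = frac_mx Y *m Phi^T <->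
    [/\ frac_mx H1 = - (frac_mx (const_pmx (invmx S)) *m
                        invmx (frac_mx (pencilA A)) *m
                        frac_mx (const_pmx B) *m frac_mx Y^T),
        H2 = N1^T *m Y^T & H3 = - (N2h *m M *m N1^T *m Y^T)].
  have -> : frac_mx Y *m Phi^T = (Phi *m frac_mx Y^T)^T.
    by rewrite trmx_mul -frac_mx_tr trmxK.
  rewrite frac_mx_tr !frac_mx_col /Phi /lin_kernel_map !mul_col_mx invS.
  rewrite -[in (frac_mx N1)^T]frac_mx_tr !mulNmx -!frac_mxM -frac_mxN.
  split=> [/trmx_inj/eq_col_mx[-> /eq_col_mx[/frac_mx_inj -> /frac_mx_inj ->]]|] //.
  by case=> -> -> ->.
split=> [[Y [minY eqY /ZE[H1E H2E H3E]]]|[H [[minH eqH] H1E H2E H3E]]].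
  by exists Y^T; split=> //; rewrite /right_minimal_basis trmxK.
by exists H^T; split=> //; apply/ZE; rewrite trmxK.
Qed.

(** * Left minimal bases by transposition *)

(** Transposition swaps the two off-diagonal blocks next to the state pencil, only one of which
    carries a minus sign; negating both B and C restores the pattern. *)
Lemma sbmb_lin_tr (F : fieldType) (p m n ph mh : nat)
    (T S A : 'M[F]_n) (B : 'M[F]_(n, m)) (C : 'M[F]_(p, n))
    (M : 'M[{poly F}]_(p + ph, m + mh))
    (K1 : 'M[{poly F}]_(mh, m + mh)) (K2 : 'M[{poly F}]_(ph, p + ph))
    (K1h : 'M[F]_(m, m + mh)) (K2h : 'M[F]_(p, p + ph)) :
  (sbmb_lin T S A B C M K1 K2 K1h K2h)^T =
  sbmb_lin S^T T^T A^T (- C^T) (- B^T) M^T K2 K1 K2h K1h.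
Proof.
rewrite /sbmb_lin !tr_col_mx !tr_row_mx -!block_mxEh -!block_mxEv.
rewrite [X in _ = col_mx _ X]block_mxEh -!block_mxEv trmxK !trmx0 linearN /=.
rewrite -!const_pmx_tr !trmx_mul trmxK pencilA_tr !const_pmx_tr.
by rewrite !(mulmxN, mulNmx, const_pmxN, opprK) !mulmxA.
Qed.

Theorem theorem6p5 (F : fieldType) (p m n ph mh : nat)
  (G : 'M[ratf F]_(p, m)) (D : 'M[{poly F}]_(p, m))
  (A : 'M[F]_n) (B : 'M[F]_(n, m)) (C : 'M[F]_(p, n))
  (K1 : 'M[{poly F}]_(mh, m + mh)) (K2 : 'M[{poly F}]_(ph, p + ph))
  (N1 : 'M[{poly F}]_(m, m + mh)) (N2 : 'M[{poly F}]_(p, p + ph))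
  (M : 'M[{poly F}]_(p + ph, m + mh))
  (K1h : 'M[F]_(m, m + mh)) (K2h : 'M[F]_(p, p + ph))
  (N1h : 'M[{poly F}]_(mh, m + mh)) (N2h : 'M[{poly F}]_(ph, p + ph))
  (T S : 'M[F]_n) :
  (* G = D + C (lambda I - A)^{-1} B, D polynomial, minimal order realization *)
  G = frac_mx D + transfer C A B ->
  minimal_order_realization C A B ->
  (1 < mxdeg D)%N ->
  (* K1, K2 minimal bases with all row degrees 1 *)
  minimal_basis K1 -> (forall i, rowdeg K1 i = 1%N) ->
  minimal_basis K2 -> (forall i, rowdeg K2 i = 1%N) ->
  (* N1, N2 dual minimal bases with all row degrees equal *)
  dual_minimal_bases K1 N1 -> (forall i j, rowdeg N1 i = rowdeg N1 j) ->
  dual_minimal_bases K2 N2 -> (forall i j, rowdeg N2 i = rowdeg N2 j) ->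
  (* M a pencil with D = N2 M N1^T and deg D = deg N1 + deg N2 + 1 *)
  is_pencil M ->
  D = N2 *m M *m N1^T ->
  mxdeg D = (mxdeg N1 + mxdeg N2 + 1)%N ->
  (* [K_i; Kh_i] unimodular with inverse [Nh_i^T  N_i^T] *)
  col_mx K1 (const_pmx K1h) *m row_mx N1h^T N1^T = 1%:M ->
  row_mx N1h^T N1^T *m col_mx K1 (const_pmx K1h) = 1%:M ->
  col_mx K2 (const_pmx K2h) *m row_mx N2h^T N2^T = 1%:M ->
  row_mx N2h^T N2^T *m col_mx K2 (const_pmx K2h) = 1%:M ->
  (* T, S nonsingular *)
  T \in unitmx -> S \in unitmx ->
  let L := sbmb_lin T S A B C M K1 K2 K1h K2h in
  (* (a) right minimal bases *)
  (forall (k : nat) (H1 : 'M[{poly F}]_(n, k)) (H2 : 'M[{poly F}]_(m + mh, k))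
          (H3 : 'M[{poly F}]_(ph, k)),
     right_minimal_basis (frac_mx L) (col_mx H1 (col_mx H2 H3)) <->
     exists H : 'M[{poly F}]_(m, k),
       [/\ right_minimal_basis G H,
           frac_mx H1 = - (frac_mx (const_pmx (invmx S)) *m
                           invmx (frac_mx (pencilA A)) *m
                           frac_mx (const_pmx B) *m frac_mx H),
           H2 = N1^T *m H &
           H3 = - (N2h *m M *m N1^T *m H)]) /\
  (* (b) left minimal bases *)
  (forall (k : nat) (H1 : 'M[{poly F}]_(n, k)) (H2 : 'M[{poly F}]_(p + ph, k))
          (H3 : 'M[{poly F}]_(mh, k)),
     left_minimal_basis (frac_mx L) (col_mx H1 (col_mx H2 H3)) <->
     exists H : 'M[{poly F}]_(p, k),
       [/\ left_minimal_basis G H,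
           frac_mx H1 = (frac_mx (const_pmx C) *m
                         invmx (frac_mx (pencilA A)) *m
                         frac_mx (const_pmx (invmx T)))^T *m frac_mx H,
           H2 = N2^T *m H &
           H3 = - (N1h *m M^T *m N2^T *m H)]).
Proof.
move=> -> minABC degD minK1 degK1 minK2 degK2 [_ minN1 _ _] degN1 [_ minN2 _ _] degN2.
move=> penM DE _ inv1 inv1' inv2 inv2' unitT unitS L.
have nzD : D != 0.
  apply: contraTneq degD => ->; rewrite -leqNgt; apply/bigmax_leqP => i _.
  by apply/rowdeg_leP => j; rewrite mxE size_poly0.
split=> k H1 H2 H3; first exact:
  (right_minimal_basis_sbmb_lin H1 H2 H3 minABC nzD minK2 degK2 minN1 degN1
    penM DE inv1 inv1' inv2 inv2' unitT unitS).
have := @right_minimal_basis_sbmb_lin F m p n mh ph k D^T A^T (- C^T) (- B^T)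
  K2 K1 N2 N1 M^T K2h K1h N2h N1h S^T T^T H1 H2 H3.
rewrite -sbmb_lin_tr transferN transfer_tr /left_minimal_basis /right_minimal_basis.
rewrite !frac_mx_tr -[_ + _^T]linearD /= !trmxK.
move=> right; apply: (iff_trans (right _ _ _ _ _ _ _ _ _ _ _ _ _ _)) => //.
- exact: minimal_order_realization_tr.
- by rewrite -(inj_eq trmx_inj) trmxK trmx0.
- by move=> i j; rewrite mxE.
- by rewrite DE !trmx_mul trmxK mulmxA.
- by rewrite unitmx_tr.
- by rewrite unitmx_tr.
(* The sign of the right-hand formula cancels that of [- C^T], which is why no minus sign precedes
   the first block in the left case. *)
have E : - (frac_mx (const_pmx (invmx T^T)) *m invmx (frac_mx (pencilA A^T)) *m
            frac_mx (const_pmx (- C^T))) =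
  (frac_mx (const_pmx C) *m invmx (frac_mx (pencilA A)) *m
   frac_mx (const_pmx (invmx T)))^T.
  rewrite const_pmxN frac_mxN mulmxN opprK -trmx_inv pencilA_tr !const_pmx_tr.
  by rewrite !frac_mx_tr -trmx_inv !trmx_mul mulmxA.
by split=> -[H [basisH H1E H2E H3E]]; exists H; split=> //; move: H1E;
  rewrite -mulNmx E.
Qed.
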